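(* Let $m$ be a positive integer, let $P\colon\Sigma\to\mathbb{R}\mathrm{P}^n$ be a BS-Kœnigs net and let $D$ be its diagonal intersection net. (1) $P_{m}$ is Laplace degenerate if and only if $D_{-m}$ is Laplace degenerate (assuming $P_m$ and $D_{-m}$ exist). (2) If $P_{m}$ is Goursat degenerate, then $D_{-m-1}$ is Laplace degenerate (assuming $D_{-m-1}$ exists).
   Context: Notation: $\Sigma_k=\{0,1,\dots,k\}$, $\Sigma_{a,b}=\Sigma_a\times\Sigma_b$; $\Sigma$ denotes either $\mathbb{Z}^2$ or some $\Sigma_{a,b}$. $A\vee B$ is the join (span) of projective subspaces. Q-nets: a Q-net is a map $P\colon\Sigma\to\mathbb{R}\mathrm{P}^n$ such that for every unit square (face) of $\Sigma$ the four image points are contained in a plane. It is non-degenerate if (i) the two points at the ends of every edge are distinct, and (ii) for any three vertices of any face the corresponding points of $P$ span a plane. Laplace transforms: for a non-degenerate Q-net $P$, $\mathcal{L}_{+}P(i,j)=(P(i,j)\vee P(i,j+1))\cap(P(i+1,j)\vee P(i+1,j+1))$ and $\mathcal{L}_{-}P(i,j)=(P(i,j)\vee P(i+1,j))\cap(P(i,j+1)\vee P(i+1,j+1))$, defined for all $(i,j)$ such that the unit square with lower left corner $(i,j)$ lies in $\Sigma$ (so on $\Sigma_{a-1,b-1}$ if $\Sigma=\Sigma_{a,b}$). These are again Q-nets. Put $P_0=P$, $P_k=(\mathcal{L}_+)^kP$ and $P_{-k}=(\mathcal{L}_-)^kP$ for $k\ge 0$. $P_{k}$ (resp. $P_{-k}$),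 $k\geq 1$, exists if all of $P_0,P_{1},\dots,P_{k-1}$ (resp. $P_0,P_{-1},\dots,P_{-(k-1)}$) are non-degenerate and the domain is non-empty; saying that $P_{\pm k}$ is degenerate in one of the senses below includes that it exists. Degeneracies, for a positive integer $k$: $P_{k}$ is Laplace degenerate if $P_{k}(i,j)$ is independent of $i$ for all $j$; $P_{-k}$ is Laplace degenerate if $P_{-k}(i,j)$ is independent of $j$ for all $i$. $P_k$ is nowhere Laplace degenerate if $P_k(i,j)\ne P_k(i+1,j)$ for all $i,j$. $P_k$ is Goursat degenerate if $P_k(i,j)$ is independent of $j$ for all $i$ and $P_k$ is nowhere Laplace degenerate. Laplace invariants: for four points on a projective line with representative vectors $p_1,\dots,p_4\in\mathbb{R}^2$, $\mathrm{cr}(P_1,P_2,P_3,P_4)=\frac{\det(p_1,p_2)\det(p_3,p_4)}{\det(p_2,p_3)\det(p_4,p_1)}$. For a non-degenerate Q-net $P$, $H(i,j)=\mathrm{cr}(P(i,j),P_1(i,j),P(i,j+1),P_1(i-1,j))$ and $K(i,j)=\mathrm{cr}(P(i,j),P_{-1}(i,j),P(i+1,j),P_{-1}(i,j-1))$, wherever the points involved are defined. A BS-Kœnigs net is a non-degenerate Q-net with $H(i,j)H(i,j+1)=K(i,j+1)K(i-1,j+1)$ for all $(i,j)\in\Sigma$ for which all four terms are defined. The diagonal intersection net $D$ of a non-degenerate Q-net $P$ is $D(i,j)=(P(i,j)\vee P(i+1,j+1))\cap(P(i+1,j)\vee P(i,j+1))$, defined for every $(i,j)$ such that the unit square with lower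 left corner $(i,j)$ lies in $\Sigma$ (so on $\Sigma_{a-1,b-1}$ if $\Sigma=\Sigma_{a,b}$). For a BS-Kœnigs net $P$, $D$ is a Q-net. $D_{k}$ denotes the iterated Laplace transform of $D$ (not the diagonal intersection net of $P_k$), with existence and degeneracy defined as for $P$.
   Formalization: On a finite grid the ''if'' half of (1) is false: D_{-m} does not constrain the bottom and top rows of P_m. There D_{-m} Laplace degenerate is shown equivalent to P_m(i,j) being independent of i for all other rows j; on Z^2 the full equivalence holds. *)

(* Defs.v *)
From HB Require Import structures.
From mathcomp Require Import all_boot all_order all_algebra.
From mathcomp Require Import ring reals.

Set Implicit Arguments.
Unset Strict Implicit.
Unset Printing Implicit Defensive.

Import Order.TTheory GRing.Theory Num.Theory.
Local Open Scope ring_scope.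

(* A projective subspace of RP^n is a linear subspace of R^(n+1), of dimension
   one more; join is the sum (U + V)%VS and intersection is (U :&: V)%VS. *)
Notation psubspace R n := {vspace 'rV[R]_n.+1}.

Section Projective.
Variables (R : realType) (n : nat).
Implicit Types (U L : psubspace R n).

Definition is_point U : Prop := \dim U = 1%N.
Definition is_plane U : Prop := \dim U = 3%N.

(* Coordinates of v in a basis of the projective line L, i.e. of a subspace of
   dimension 2. *)
Definition line_coord L (v : 'rV[R]_n.+1) : 'rV[R]_2 :=
  \row_k coord [tuple (vbasis L)`_0; (vbasis L)`_1] k v.

Definition det2 (p q : 'rV[R]_2) : R := \det (col_mx p q : 'M_(1 + 1)).

Definition cr2 (p1 p2 p3 p4 : 'rV[R]_2) : R :=
  (det2 p1 p2 * det2 p3 p4) / (det2 p2 p3 * det2 p4 p1).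

(* [cross_ratioE] below: any other basis of the line and any other
   representative vectors give the same value. *)
Definition cross_ratio (P1 P2 P3 P4 : psubspace R n) : R :=
  let c P := line_coord (P1 + P2 + P3 + P4)%VS (vpick P) in
  cr2 (c P1) (c P2) (c P3) (c P4).

End Projective.

Section CrossRatio.
Variables (R : realType) (n : nat).
Implicit Types (p q : 'rV[R]_2) (M : 'M[R]_2).

Lemma det2Z a b p q : det2 (a *: p) (b *: q) = a * b * det2 p q.
Proof.
rewrite /det2; have -> : col_mx (a *: p) (b *: q) =
    block_mx a%:M 0 0 b%:M *m (col_mx p q : 'M_(1 + 1)).
  by rewrite mul_block_col !mul0mx addr0 add0r !mul_scalar_mx.
by rewrite det_mulmx det_ublock !det_scalar1.
Qed.

Lemma det2M p q M : det2 (p *m M) (q *m M) = det2 p q * \det M.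
Proof. by rewrite /det2 -det_mulmx -mul_col_mx. Qed.

Lemma cr2_proj (a1 a2 a3 a4 : R) p1 p2 p3 p4 M :
  a1 != 0 -> a2 != 0 -> a3 != 0 -> a4 != 0 -> \det M != 0 ->
  cr2 (a1 *: (p1 *m M)) (a2 *: (p2 *m M)) (a3 *: (p3 *m M)) (a4 *: (p4 *m M)) =
  cr2 p1 p2 p3 p4.
Proof.
move=> h1 h2 h3 h4 hM; rewrite /cr2 !det2Z !det2M.
set c := a1 * a2 * a3 * a4 * \det M ^+ 2.
have hc : c != 0 by rewrite /c !mulf_neq0 // expf_neq0.
have -> : a1 * a2 * (det2 p1 p2 * \det M) * (a3 * a4 * (det2 p3 p4 * \det M)) =
  c * (det2 p1 p2 * det2 p3 p4) by rewrite /c; ring.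
have -> : a2 * a3 * (det2 p2 p3 * \det M) * (a4 * a1 * (det2 p4 p1 * \det M)) =
  c * (det2 p2 p3 * det2 p4 p1) by rewrite /c; ring.
by rewrite -mulf_div divff // mul1r.
Qed.

Definition line_vec (e1 e2 : 'rV[R]_n.+1) p : 'rV[R]_n.+1 :=
  p 0 0 *: e1 + p 0 1 *: e2.

Lemma cross_ratioE (e1 e2 : 'rV[R]_n.+1) (p1 p2 p3 p4 : 'rV[R]_2)
    (P1 P2 P3 P4 : psubspace R n) :
  free [:: e1; e2] ->
  p1 != 0 -> p2 != 0 -> p3 != 0 -> p4 != 0 ->
  P1 = <[line_vec e1 e2 p1]>%VS ->
  P2 = <[line_vec e1 e2 p2]>%VS ->
  P3 = <[line_vec e1 e2 p3]>%VS ->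
  P4 = <[line_vec e1 e2 p4]>%VS ->
  \dim (P1 + P2 + P3 + P4)%VS = 2%N ->
  cross_ratio P1 P2 P3 P4 = cr2 p1 p2 p3 p4.
Proof.
move=> efree n1 n2 n3 n4 E1 E2 E3 E4; rewrite /cross_ratio.
set L := (P1 + P2 + P3 + P4)%VS => dimL.
pose v := line_vec e1 e2.
have vS p : v p \in <<[:: e1; e2]>>%VS.
  by rewrite /v /line_vec memvD // memvZ // memv_span // !inE eqxx ?orbT.
have LS : L = <<[:: e1; e2]>>%VS.
  apply/eqP; rewrite eqEdim (eqP (efree : \dim _ == _)) dimL leqnn andbT.
  by rewrite !subv_add E1 E2 E3 E4 -!memvE !vS.
have vL p : v p \in L by rewrite LS.
have v0 p : v p = 0 -> p = 0.
  move=> vp0; have /freeP := (efree : free [tuple e1; e2]).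
  move=> /(_ (fun k => p 0 k)).
  rewrite !big_ord_recl big_ord0 addr0 /=.
  have -> : lift ord0 ord0 = 1 :> 'I_2 by apply/val_inj.
  by move=> /(_ vp0) h; apply/rowP => k; rewrite mxE h.
pose b := [tuple (vbasis L)`_0; (vbasis L)`_1].
have bE : b = vbasis L :> seq _.
  apply: (@eq_from_nth _ 0); first by rewrite !size_tuple dimL.
  by case=> [|[|]].
have bb : basis_of L b.
  by rewrite bE; apply: vbasisP.
pose M : 'M[R]_2 :=
  \matrix_(i, k) line_coord L (if i == 0 then e1 else e2) 0 k.
have lcM p : line_coord L (v p) = p *m M.
  apply/rowP => k; rewrite mxE linearD !linearZ /= mxE !big_ord_recl big_ord0 addr0.
  rewrite !mxE /=.
  by congr (p _ _ * _ + p _ _ * _); apply/val_inj.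
have lc0 p : line_coord L (v p) = 0 -> p = 0.
  move=> h; apply: v0; rewrite (coord_basis bb (vL p)) big1 // => k _.
  by move/rowP/(_ k): h; rewrite !mxE => ->; rewrite scale0r.
have detM : \det M != 0.
  apply/negP => /det0P [x xn0 xM]; move/negP: xn0; apply; apply/eqP.
  by apply: lc0; rewrite lcM.
have pickE p (P : psubspace R n) : p != 0 -> P = <[v p]>%VS ->
    exists2 a, a != 0 & line_coord L (vpick P) = a *: (p *m M).
  move=> pn0 ->; have /vlineP [a Ea] := memv_pick <[v p]>%VS.
  exists a; last by rewrite -lcM Ea; apply/rowP => k; rewrite !mxE linearZ.
  apply/eqP => a0; move: pn0; rewrite a0 scale0r in Ea.
  have : vpick <[v p]>%VS == 0 by rewrite Ea.
  rewrite vpick0 => /eqP hv; have : v p \in <[v p]>%VS by apply: memv_line.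
  by rewrite hv memv0 => /eqP /v0 ->; rewrite eqxx.
have [a1 h1 ->] := pickE _ _ n1 E1.
have [a2 h2 ->] := pickE _ _ n2 E2.
have [a3 h3 ->] := pickE _ _ n3 E3.
have [a4 h4 ->] := pickE _ _ n4 E4.
exact: cr2_proj.
Qed.

End CrossRatio.

(* Sigma: the whole lattice Z^2, or {0,...,a} x {0,...,b}. *)
Variant index_set := Lattice | Grid of nat & nat.

Definition mem_index (S : index_set) (i j : int) : bool :=
  match S with
  | Lattice => true
  | Grid a b => (0 <= i <= a%:Z) && (0 <= j <= b%:Z)
  end.

(* A net is a map on [dom]; values outside [dom] are irrelevant.  Values are
   arbitrary subspaces so that intersections need no side condition; [is_Qnet]
   demands points. *)
Record net (R : realType) (n : nat) := Net {
  dom : int -> int -> bool;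
  at_ :> int -> int -> psubspace R n }.

Section Nets.
Variables (R : realType) (n : nat).
Implicit Types (N : net R n) (i j : int) (k : nat).

(* the unit square with lower left corner (i, j) lies in the domain *)
Definition face N i j : bool :=
  [&& dom N i j, dom N (i + 1) j, dom N i (j + 1) & dom N (i + 1) (j + 1)].

Definition is_Qnet N : Prop :=
  (forall i j, dom N i j -> is_point (N i j)) /\
  (forall i j, face N i j -> exists2 E : psubspace R n, is_plane E &
     [/\ (N i j <= E)%VS, (N (i + 1)%R j <= E)%VS,
         (N i (j + 1)%R <= E)%VS & (N (i + 1)%R (j + 1)%R <= E)%VS]).

Definition nondegenerate N : Prop :=
  [/\ forall i j, dom N i j -> dom N (i + 1) j -> N i j <> N (i + 1) j,
      forall i j, dom N i j -> dom N i (j + 1) -> N i j <> N i (j + 1)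
    & forall i j, face N i j ->
        [/\ is_plane (N i j + N (i + 1)%R j + N i (j + 1)%R)%VS,
            is_plane (N i j + N (i + 1)%R j + N (i + 1)%R (j + 1)%R)%VS,
            is_plane (N i j + N i (j + 1)%R + N (i + 1)%R (j + 1)%R)%VS
          & is_plane (N (i + 1)%R j + N i (j + 1)%R + N (i + 1)%R (j + 1)%R)%VS]].

Definition laplace_pos N : net R n :=
  Net (face N) (fun i j =>
    (N i j + N i (j + 1)%R) :&: (N (i + 1)%R j + N (i + 1)%R (j + 1)%R))%VS.

Definition laplace_neg N : net R n :=
  Net (face N) (fun i j =>
    (N i j + N (i + 1)%R j) :&: (N i (j + 1)%R + N (i + 1)%R (j + 1)%R))%VS.

Definition diagonal_net N : net R n :=
  Net (face N) (fun i j =>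
    (N i j + N (i + 1)%R (j + 1)%R) :&: (N (i + 1)%R j + N i (j + 1)%R))%VS.

(* P_k and P_{-k}, for k >= 0 *)
Definition iter_pos k N : net R n := iter k laplace_pos N.
Definition iter_neg k N : net R n := iter k laplace_neg N.

Definition exists_pos k N : Prop :=
  (forall l, (l < k)%N -> nondegenerate (iter_pos l N)) /\
  (exists i j, dom (iter_pos k N) i j).

Definition exists_neg k N : Prop :=
  (forall l, (l < k)%N -> nondegenerate (iter_neg l N)) /\
  (exists i j, dom (iter_neg k N) i j).

Definition laplace_degenerate_pos k N : Prop :=
  exists_pos k N /\
  forall i i' j, dom (iter_pos k N) i j -> dom (iter_pos k N) i' j ->
    iter_pos k N i j = iter_pos k N i' j.

Definition laplace_degenerate_neg k N : Prop :=
  exists_neg k N /\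
  forall i j j', dom (iter_neg k N) i j -> dom (iter_neg k N) i j' ->
    iter_neg k N i j = iter_neg k N i j'.

(* The condition of [laplace_degenerate_pos], required only of the rows j that
   have a row of the domain on either side.  All rows of Z^2 are of this kind; a
   grid loses its bottom and top rows, and on a grid it is only the remaining
   rows that Laplace degeneracy of [iter_neg k (diagonal_net N)] constrains. *)
Definition inner_laplace_degenerate_pos k N : Prop :=
  exists_pos k N /\
  forall i i' j, dom (iter_pos k N) i j -> dom (iter_pos k N) i' j ->
    dom (iter_pos k N) i (j - 1) -> dom (iter_pos k N) i (j + 1) ->
    iter_pos k N i j = iter_pos k N i' j.

Definition nowhere_laplace_degenerate_pos k N : Prop :=
  exists_pos k N /\
  forall i j, dom (iter_pos k N) i j -> dom (iter_pos k N) (i + 1) j ->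
    iter_pos k N i j <> iter_pos k N (i + 1) j.

Definition goursat_degenerate_pos k N : Prop :=
  [/\ exists_pos k N,
      forall i j j', dom (iter_pos k N) i j -> dom (iter_pos k N) i j' ->
        iter_pos k N i j = iter_pos k N i j'
    & nowhere_laplace_degenerate_pos k N].

Definition invH N i j : R :=
  cross_ratio (N i j) (laplace_pos N i j) (N i (j + 1)) (laplace_pos N (i - 1) j).

Definition invK N i j : R :=
  cross_ratio (N i j) (laplace_neg N i j) (N (i + 1) j) (laplace_neg N i (j - 1)).

Definition domH N i j : bool :=
  [&& dom N i j, dom (laplace_pos N) i j, dom N i (j + 1)
    & dom (laplace_pos N) (i - 1) j].

Definition domK N i j : bool :=
  [&& dom N i j, dom (laplace_neg N) i j, dom N (i + 1) j
    & dom (laplace_neg N) i (j - 1)].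

Definition is_BSKoenigs N : Prop :=
  [/\ is_Qnet N, nondegenerate N
    & forall i j, dom N i j ->
        domH N i j -> domH N i (j + 1) ->
        domK N i (j + 1) -> domK N (i - 1) (j + 1) ->
        invH N i j * invH N i (j + 1) = invK N i (j + 1) * invK N (i - 1) (j + 1)].

End Nets.

(* Main.v *)
(* Lift P to vectors x with x12 = a x + b x1 + c x2 on every face (an index 1 or 2
   is a shift in that direction).  Then H and K are monomials in a, b, c, and
   P_1 = [a x + c x2] satisfies a face equation of the same kind, which gives a
   Toda-type recursion for (H, K) under both Laplace transforms.  For
   D = [b x1 + c x2] the BS-Koenigs condition yields
     K_D(i,j) = H_P(i+1,j)  and  H_D(i,j) = K_P(i,j+1),
   and by the symmetry of the recursion this swap persists between P_k and D_{-k}.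
   Since P_{k+1}(i,j) = P_{k+1}(i+1,j) iff H_{P_k}(i+1,j) = 1, and likewise for
   D_{-k-1} and K, part (1) follows; a Goursat degenerate P_m has H = 1, which is
   K = 1 for D_{-m}, hence part (2). *)
From mathcomp Require Import all_boot all_order all_algebra.
From mathcomp Require Import zify ring boolp reals.
Require Import Defs.

Set Implicit Arguments.
Unset Strict Implicit.
Unset Printing Implicit Defensive.

Import Order.TTheory GRing.Theory Num.Theory.
Local Open Scope ring_scope.

(** * Independent triples and intersections of lines in a plane *)

Section LinearAlgebra.
Variables (F : fieldType) (n : nat).
Implicit Types (u v w : 'rV[F]_n).

Lemma dim3_indep u v w : \dim (<[u]> + <[v]> + <[w]>)%VS = 3%N ->
  forall a b c, a *: u + b *: v + c *: w = 0 -> [/\ a = 0, b = 0 & c = 0].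
Proof.
move=> d3 a b c e.
have /freeP fr : free [tuple u; v; w].
  by rewrite /free /= !span_cons span_nil addv0 addvA d3.
pose k (i : 'I_3) := [:: a; b; c]`_i.
have := fr k; rewrite !big_ord_recl big_ord0 /= addr0 addrA => /(_ e) h.
by split; [move: (h 0) | move: (h 1) | move: (h (Ordinal (isT : (2 < 3)%N)))].
Qed.

(** Dropping the [w] term moves a point along its line through [w] onto the line of [u] and [v].
    Laplace and diagonal points are all computed this way. *)
Lemma line_meet u v w a b c : \dim (<[u]> + <[w]> + <[v]>)%VS = 3%N ->
  ((<[u]> + <[v]>) :&: (<[w]> + <[a *: u + b *: w + c *: v]>))%VS
  = <[a *: u + c *: v]>%VS.
Proof.
move=> d3; apply/vspaceP => z; rewrite memv_cap; apply/andP/vlineP.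
  case=> /memv_addP[_ /vlineP[k1 ->] [_ /vlineP[k2 ->] ->]].
  case/memv_addP=> _ /vlineP[k3 ->] [_ /vlineP[k4 ->] e].
  have [|e1 _ e2] := dim3_indep d3 (a := k1 - k4 * a) (b := - k3 - k4 * b)
                        (c := k2 - k4 * c).
    apply/rowP => i; move/rowP/(_ i): e; rewrite !mxE => /eqP.
    by rewrite -subr_eq0 => /eqP <-; ring.
  exists k4; rewrite scalerDr !scalerA.
  by move/subr0_eq: e1 => ->; move/subr0_eq: e2 => ->.
case=> k ->; split.
  by rewrite memvZ // memv_add // memvZ ?memv_line.
have -> : a *: u + c *: v = (- b) *: w + (a *: u + b *: w + c *: v).
  by apply/rowP => i; rewrite !mxE; ring.
by rewrite memvZ // memv_add ?memvZ ?memv_line.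
Qed.

Lemma eq_line u v : v != 0 -> <[u]>%VS = <[v]>%VS -> exists2 k, k != 0 & v = k *: u.
Proof.
move=> v0 e; have /vlineP[k ek] : v \in <[u]>%VS by rewrite e memv_line.
by exists k => //; apply: contraNneq v0 => k0; rewrite ek k0 scale0r.
Qed.

Lemma vlineZ k u : k != 0 -> <[k *: u]>%VS = <[u]>%VS.
Proof.
move=> k0; apply/eqP; rewrite eqEsubv -!memvE memvZ ?memv_line //=.
by rewrite -[X in X \in _](scalerK k0) memvZ ?memv_line.
Qed.

End LinearAlgebra.

(** * Reflection of the lattice and homogeneous lifts of nets *)

Section Nets.
Variables (R : realType) (n : nat).
Implicit Types (N M P : net R n) (i j : int).

(** Swapping the indices exchanges the two Laplace transforms and the invariants H and K, so facts
    about [laplace_neg] follow from those about [laplace_pos]. *)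
Definition tr N : net R n := Net (fun i j => dom N j i) (fun i j => N j i).

Lemma face_tr N i j : face (tr N) i j = face N j i.
Proof. by rewrite /face /=; congr (_ && _); rewrite andbCA. Qed.

Lemma laplace_neg_tr N : laplace_neg N = tr (laplace_pos (tr N)).
Proof.
congr Net; apply: funext => i; apply: funext => j; rewrite /= ?face_tr //.
Qed.

Lemma face_corners N i j : face N i j ->
  [/\ dom N i j, dom N (i + 1) j, dom N i (j + 1) & dom N (i + 1) (j + 1)].
Proof. by case/and4P. Qed.

Lemma nondegenerate_tr N : nondegenerate N -> nondegenerate (tr N).
Proof.
case=> h1 h2 h3; split=> [i j|i j|i j]; [exact: h2|exact: h1|rewrite face_tr].
case/h3 => f1 f2 f3 f4; split=> //=; last by rewrite (addvC (N _ _)).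
by rewrite -addvA (addvC (N _ (_ + 1))) addvA.
Qed.

(* Homogeneous coordinates [vec] of a net, with
   vec(i+1,j+1) = ca vec(i,j) + cb vec(i+1,j) + cc vec(i,j+1) on every face. *)
Record lift := Lift {
  vec : int -> int -> 'rV[R]_n.+1;
  ca : int -> int -> R; cb : int -> int -> R; cc : int -> int -> R }.
Implicit Types (X Y : lift).

Definition lifts N X : Prop :=
  (forall i j, dom N i j -> vec X i j != 0 /\ N i j = <[vec X i j]>%VS) /\
  (forall i j, face N i j ->
     [/\ vec X (i + 1) (j + 1) = ca X i j *: vec X i j
           + cb X i j *: vec X (i + 1) j + cc X i j *: vec X i (j + 1),
         ca X i j != 0, cb X i j != 0 & cc X i j != 0]).

Definition lift_tr X := Lift (fun i j => vec X j i) (fun i j => ca X j i)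
  (fun i j => cc X j i) (fun i j => cb X j i).

(* [hinv X i j] is the Laplace invariant H(i+1,j), [kinv X i j] is K(i,j+1). *)
Definition hinv X i j : R := - (cc X (i + 1) j * cb X i j) / ca X (i + 1) j.
Definition kinv X i j : R := hinv (lift_tr X) j i.

Lemma lifts_tr N X : lifts N X -> lifts (tr N) (lift_tr X).
Proof.
case=> h1 h2; split=> i j; first exact: h1.
by rewrite face_tr => /h2[e ? ? ?]; split=> //=; rewrite e addrAC.
Qed.

Lemma lifts_face N X i j : lifts N X -> nondegenerate N -> face N i j ->
  forall a b c, a *: vec X i j + b *: vec X (i + 1) j + c *: vec X i (j + 1) = 0 ->
  [/\ a = 0, b = 0 & c = 0].
Proof.
case=> h _ [_ _ g] f; have [d1 d2 d3 _] := face_corners f.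
case: (g _ _ f) => + _ _ _.
by rewrite (h _ _ d1).2 (h _ _ d2).2 (h _ _ d3).2 => /dim3_indep.
Qed.

(** Planarity of a face yields the linear relation; a zero coefficient would make three of its
    vertices dependent, against non-degeneracy. *)
Lemma exists_lift N : is_Qnet N -> nondegenerate N -> exists X, lifts N X.
Proof.
case=> hpt hpl [_ _ nd].
pose x i j := vpick (N i j).
have xP i j : dom N i j -> x i j != 0 /\ N i j = <[x i j]>%VS.
  move/hpt; rewrite /is_point => d1.
  have x0 : x i j != 0 by rewrite vpick0 -dimv_eq0 d1.
  split=> //; apply/eqP; rewrite eq_sym eqEdim -memvE memv_pick d1.
  by rewrite dim_vline x0.
have cP (ij : int * int) : exists abc : R * R * R, let: (i, j) := ij in
    let: (a, b, c) := abc in face N i j ->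
    [/\ x (i + 1) (j + 1) = a *: x i j + b *: x (i + 1) j + c *: x i (j + 1),
        a != 0, b != 0 & c != 0].
  case: ij => i j; case: (boolP (face N i j)) => [f|]; last by exists (0, 0, 0).
  have [/xP[_ e1] /xP[_ e2] /xP[_ e3] /xP[_ e4]] := face_corners f.
  have [E dE [s1 s2 s3 s4]] := hpl _ _ f; have [p1 p2 p3 p4] := nd _ _ f.
  rewrite /is_plane e1 e2 e3 e4 in p1 p2 p3 p4.
  have EE : (<[x i j]> + <[x (i + 1)%R j]> + <[x i (j + 1)%R]>)%VS = E.
    by apply/eqP; rewrite eqEdim p1 dE !subv_add -e1 -e2 -e3 s1 s2 s3.
  have : x (i + 1) (j + 1) \in E by rewrite memvE -e4.
  rewrite -EE => /memv_addP[_ /memv_addP[_ /vlineP[a ->] [_ /vlineP[b ->] ->]]].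
  case=> _ /vlineP[c ->] e; exists (a, b, c) => _; split=> //.
  - apply/eqP => a0; case: (dim3_indep p4 (a := b) (b := c) (c := -1)).
      by rewrite e a0 scale0r add0r scaleN1r subrr.
    by move=> _ _ /eqP; rewrite oppr_eq0 oner_eq0.
  - apply/eqP => b0; case: (dim3_indep p3 (a := a) (b := c) (c := -1)).
      by rewrite e b0 scale0r addr0 scaleN1r subrr.
    by move=> _ _ /eqP; rewrite oppr_eq0 oner_eq0.
  - apply/eqP => c0; case: (dim3_indep p2 (a := a) (b := b) (c := -1)).
      by rewrite e c0 scale0r addr0 scaleN1r subrr.
    by move=> _ _ /eqP; rewrite oppr_eq0 oner_eq0.
have [f fP] := boolp.choice cP.
exists (Lift x (fun i j => (f (i, j)).1.1) (fun i j => (f (i, j)).1.2)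
          (fun i j => (f (i, j)).2)).
split=> // i j /=.
by have := fP (i, j); case: (f (i, j)) => [[a b] c].
Qed.

(** * Laplace transforms of lifts and the recursion for H and K *)

Definition lift_pos X : lift :=
  let a i j :=
    ca X (i + 1) (j + 1) * (1 - hinv X i (j + 1)) / (1 - hinv X i j) in
  Lift (fun i j => ca X i j *: vec X i j + cc X i j *: vec X i (j + 1))
    a (fun i j => a i j * cb X i j / ca X (i + 1) j)
    (fun i j => cc X (i + 1) (j + 1)).

Definition lift_neg X : lift := lift_tr (lift_pos (lift_tr X)).

Lemma laplace_pos_line N X i j : lifts N X -> nondegenerate N -> face N i j ->
  vec (lift_pos X) i j != 0 /\ laplace_pos N i j = <[vec (lift_pos X) i j]>%VS.
Proof.
move=> lX nd f; have [d1 d2 d3 d4] := face_corners f; case: (lX) => h1 h2.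
have [e a0 _ c0] := h2 _ _ f; split.
  apply/eqP => /= y0; case: (lifts_face lX nd f (a := ca X i j) (b := 0) (c := cc X i j)).
    by rewrite scale0r addr0.
  by move/eqP: a0.
rewrite /= (h1 _ _ d1).2 (h1 _ _ d2).2 (h1 _ _ d3).2 (h1 _ _ d4).2 e line_meet //.
case: nd => _ _ /(_ _ _ f)[+ _ _ _].
by rewrite (h1 _ _ d1).2 (h1 _ _ d2).2 (h1 _ _ d3).2.
Qed.

(** Both Laplace points lie on the line through P(i+1,j) and P(i+1,j+1). Substituting the face
    equation at (i,j) for vec(i+1,j+1) leaves a vec(i+1,j) term that measures their deviation. *)
Lemma lift_pos_step N X i j : lifts N X -> face N i j -> face N (i + 1) j ->
  vec (lift_pos X) (i + 1) j = cc X (i + 1) j *: vec (lift_pos X) i j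
    + (ca X (i + 1) j * (1 - hinv X i j)) *: vec X (i + 1) j.
Proof.
case=> _ h /h[e _ _ _] /h[_ a0 _ _] /=; rewrite e.
by apply/rowP => k; rewrite !mxE /hinv; field.
Qed.

(** By [lift_pos_step], the points agree if the vec(i+1,j) term vanishes; conversely, comparing
    coefficients in the independent vectors of the face forces it to vanish. *)
Lemma laplace_pos_eq N X i j : lifts N X -> nondegenerate N ->
  face N i j -> face N (i + 1) j ->
  laplace_pos N i j = laplace_pos N (i + 1) j <-> hinv X i j = 1.
Proof.
move=> lX nd f f1; have e := lift_pos_step lX f f1.
have [y0 ey] := laplace_pos_line lX nd f.
have [y10 ey1] := laplace_pos_line lX nd f1.
have [_ a0 _ c0] := lX.2 _ _ f1; have [_ a00 _ _] := lX.2 _ _ f.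
rewrite ey ey1; split=> [|h].
  case/(eq_line y10) => k _; rewrite e => e1.
  have [|_ + _] := lifts_face lX nd f (a := (cc X (i + 1) j - k) * ca X i j)
    (b := ca X (i + 1) j * (1 - hinv X i j)) (c := (cc X (i + 1) j - k) * cc X i j).
    move/eqP: e1; rewrite -subr_eq0 => /eqP <- /=.
    by apply/rowP => l; rewrite !mxE; ring.
  by move=> /eqP; rewrite mulf_eq0 (negPf a0) /= subr_eq0 => /eqP.
by rewrite e h subrr mulr0 scale0r addr0 vlineZ.
Qed.

Lemma lifts_pos N X : lifts N X -> nondegenerate N ->
  (forall i j, face N i j -> face N (i + 1) j ->
     laplace_pos N i j <> laplace_pos N (i + 1) j) ->
  lifts (laplace_pos N) (lift_pos X).
Proof.
move=> lX nd ne; split=> i j; first exact: laplace_pos_line.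
move=> f; have [f1 f2 f3 f4] := face_corners f.
have h1 : 1 - hinv X i j != 0.
  by rewrite subr_eq0 eq_sym; apply/eqP => /(laplace_pos_eq lX nd f1 f2); apply: ne.
have h2 : 1 - hinv X i (j + 1) != 0.
  by rewrite subr_eq0 eq_sym; apply/eqP => /(laplace_pos_eq lX nd f3 f4); apply: ne.
have [e1 a1 b1 c1] := lX.2 _ _ f1; have [_ a2 b2 c2] := lX.2 _ _ f2.
have [_ a3 b3 c3] := lX.2 _ _ f3; have [_ a4 b4 c4] := lX.2 _ _ f4.
split; try by rewrite /= ?mulf_neq0 ?invr_neq0.
(* [s2] and [e0] bring the left side, [s1] the right side, to two Laplace points and vec(i+1,j).
   Solving [s1] for that last vector is where the coefficients of [lift_pos] come from. *)
have s1 := lift_pos_step lX f1 f2; have s2 := lift_pos_step lX f3 f4.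
have e0 : vec X (i + 1) (j + 1) =
    vec (lift_pos X) i j + cb X i j *: vec X (i + 1) j.
  by rewrite e1 /= addrAC.
rewrite s2 e0 s1; apply/rowP => k.
set y := vec (lift_pos X); set x := vec X.
rewrite !mxE /=.
have hE : hinv X i j * ca X (i + 1) j = - (cc X (i + 1) j * cb X i j).
  by rewrite /hinv divfK.
have -> : cc X (i + 1) j = - hinv X i j * ca X (i + 1) j / cb X i j.
  by rewrite mulNr hE opprK mulfK.
move: (y i j 0 k) (y i (j + 1) 0 k) (x (i + 1) j 0 k) => y1 y2 x1.
move: h1 h2; move: (hinv X i j) (hinv X i (j + 1)) => hh h' h1 h2.
by field; rewrite ?h1 ?a2 ?b1.
Qed.

Lemma kinv_lift_pos N X i j : lifts N X -> lifts (laplace_pos N) (lift_pos X) ->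
  face (laplace_pos N) i j -> face (laplace_pos N) i (j + 1) ->
  kinv (lift_pos X) i j = hinv X i (j + 1).
Proof.
move=> lX lY f g; have [_ a0 _ _] := lY.2 _ _ g.
have [f1 f2 f3 f4] := face_corners f.
have [_ a4 _ _] := lX.2 _ _ f4.
move: a0; rewrite /kinv /hinv /=.
set h1 := 1 - _; set h2 := 1 - _.
(* As 0^-1 = 0, a nonzero coefficient [ca] of the transform also shows that its denominator 1 -
   [hinv] is nonzero. *)
rewrite !mulf_eq0 invr_eq0 !negb_or => /andP[/andP[u1 u2] u3].
by field; rewrite u1 u2 u3 a4.
Qed.

(** The Toda-type equation: the quotient of two [ca] coefficients of the transform produces the 1 -
    [hinv] factors, and the remaining monomial is expressed by [hinv] and [kinv] of [X]. *)
Lemma hinv_lift_pos N X i j : lifts N X -> lifts (laplace_pos N) (lift_pos X) ->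
  face (laplace_pos N) i j -> face (laplace_pos N) (i + 1) j ->
  hinv (lift_pos X) i j = hinv X i j * hinv X (i + 1) (j + 1) / kinv X (i + 1) j
    * ((1 - hinv X i (j + 1)) * (1 - hinv X (i + 1) j))
    / ((1 - hinv X i j) * (1 - hinv X (i + 1) (j + 1))).
Proof.
move=> lX lY f g; have [_ a1 _ _] := lY.2 _ _ f; have [_ a2 _ _] := lY.2 _ _ g.
have [_ f2 _ f4] := face_corners f; have [_ _ _ g4] := face_corners g.
have [_ a4 b4 c4] := lX.2 _ _ f4; have [_ a3 b3 c3] := lX.2 _ _ f2.
have [_ a5 b5 c5] := lX.2 _ _ g4.
(* With the monomial written in coefficients, the [hinv] values left in the 1 - [hinv] factors can
   be treated as free variables. *)
have -> : hinv X i j * hinv X (i + 1) (j + 1) / kinv X (i + 1) j =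
    - (cc X (i + 1 + 1) (j + 1) * cb X i j * ca X (i + 1) (j + 1))
    / (ca X (i + 1) j * ca X (i + 1 + 1) (j + 1)).
  by rewrite /kinv /hinv /=; field; rewrite a3 a4 a5 b4 c3.
move: a1 a2; rewrite [LHS]/hinv /= !mulf_eq0 !invr_eq0 !negb_or.
move=> /andP[/andP[_ u1] u2] /andP[/andP[_ v1] v2].
move: u1 u2 v1 v2.
move: (hinv X i j) (hinv X i (j + 1)) (hinv X (i + 1) j) (hinv X (i + 1) (j + 1)).
move=> h1 h2 h3 h4 u1 u2 v1 v2.
by field; rewrite a3 a5 u2 v1 v2.
Qed.

(** * Goursat degeneracy, and the invariants as cross-ratios *)

Lemma line_indep (x y : 'rV[R]_n.+1) a b : x != 0 -> y != 0 ->
  <[x]>%VS <> <[y]>%VS -> a *: x + b *: y = 0 -> a = 0 /\ b = 0.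
Proof.
move=> x0 y0 ne e.
have b0 : b = 0.
  apply/eqP/negP => /negP b0; apply: ne.
  have ey : y = (- (b^-1 * a)) *: x.
    have {1}-> : y = b^-1 *: (b *: y) by rewrite scalerK.
    by move/eqP: e; rewrite addrC addr_eq0 => /eqP ->; rewrite scalerN scalerA scaleNr.
  rewrite ey vlineZ //; apply: contraNneq y0 => k0.
  by rewrite ey k0 scale0r.
split=> //; move/eqP: e; rewrite b0 scale0r addr0 scaler_eq0 (negPf x0) orbF.
by move/eqP.
Qed.

(** The upper vertices of a face are multiples of the lower ones, so its face equation relates two
    independent vectors. On adjacent faces this gives cb(i,j) = c1 and ca(i+1,j) = - cc(i+1,j) c1,
    where c1 is the factor on the shared edge. *)
Lemma goursat_hinv N X i j : lifts N X ->
  (forall k, dom N k j -> dom N k (j + 1) -> N k j = N k (j + 1)) ->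
  (forall k, dom N k j -> dom N (k + 1) j -> N k j <> N (k + 1) j) ->
  face N i j -> face N (i + 1) j -> hinv X i j = 1.
Proof.
move=> [h1 h2] hj hi f g.
have [f1 f2 f3 f4] := face_corners f; have [_ g2 _ g4] := face_corners g.
have nx k : dom N k j -> dom N k (j + 1) ->
    exists2 c, c != 0 & vec X k (j + 1) = c *: vec X k j.
  move=> d1 d2; have [_ e1] := h1 _ _ d1; have [x0 e2] := h1 _ _ d2.
  by apply: eq_line => //; rewrite -e1 -e2; apply: hj.
have ind k a b : dom N k j -> dom N (k + 1) j ->
    a *: vec X k j + b *: vec X (k + 1) j = 0 -> a = 0 /\ b = 0.
  move=> d1 d2; have [x0 e1] := h1 _ _ d1; have [x1 e2] := h1 _ _ d2.
  by apply: line_indep => //; rewrite -e1 -e2; apply: hi.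
have [c _ ec] := nx _ f1 f3; have [c1 _ ec1] := nx _ f2 f4.
have [c2 _ ec2] := nx _ g2 g4.
have [e _ _ _] := h2 _ _ f; have [e' a0 _ _] := h2 _ _ g.
have [|_ /subr0_eq eb] := ind i (ca X i j + cc X i j * c) (cb X i j - c1) f1 f2.
  rewrite ec ec1 in e; rewrite scalerBl e.
  by apply/rowP => k; rewrite !mxE; ring.
have [|ea _] := ind (i + 1) (ca X (i + 1) j + cc X (i + 1) j * c1)
                   (cb X (i + 1) j - c2) f2 g2.
  rewrite ec1 ec2 in e'; rewrite scalerBl e'.
  by apply/rowP => k; rewrite !mxE; ring.
move/eqP: ea; rewrite addrC addr_eq0 => /eqP ea.
by rewrite /hinv eb ea opprK divff.
Qed.

Lemma invHE N X i j : lifts N X -> nondegenerate N ->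
  face N i j -> face N (i + 1) j -> invH N (i + 1) j = hinv X i j.
Proof.
move=> lX nd f g; have [d1 d2 d3 d4] := face_corners f.
have [_ d6 _ d8] := face_corners g.
have [[x1 E1] [x12 E12]] := (lX.1 _ _ d2, lX.1 _ _ d4).
have [y0 Y0] := laplace_pos_line lX nd f.
have [y1 Y1] := laplace_pos_line lX nd g.
have [e a0 b0 c0] := lX.2 _ _ f; have [_ a1 b1 c1] := lX.2 _ _ g.
pose v (a b : R) : 'rV[R]_2 := \row_k (if k == 0 then a else b).
have lv a b : line_vec (vec X (i + 1) j) (vec X (i + 1) (j + 1)) (v a b) =
    a *: vec X (i + 1) j + b *: vec X (i + 1) (j + 1).
  by rewrite /line_vec !mxE.
have v0 a b : (a != 0) || (b != 0) -> v a b != 0.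
  apply: contraTneq => /rowP h; rewrite negb_or !negbK.
  by move: (h 0) (h 1); rewrite !mxE /= => -> ->; rewrite eqxx.
have ind : free [:: vec X (i + 1) j; vec X (i + 1) (j + 1)].
  apply/(@freeP _ _ _ [tuple _; _]) => k.
  rewrite !big_ord_recl big_ord0 /= addr0 => ek.
  have [|k0 k1] := line_indep x1 x12 _ ek.
    by rewrite -E1 -E12; case: nd => _ h _; apply: h.
  case=> [[|[|//]]] p; [rewrite -k0|rewrite -k1]; congr k; exact: val_inj.
rewrite /invH addrK.
have dv a b c d : det2 (v a b) (v c d) = a * d - b * c.
  rewrite /det2 (expand_det_row _ 0) !big_ord_recl big_ord0 /cofactor !det_mx11.
  rewrite !mxE /=; do !(case: splitP => [[[|//] ?]|[[|//] ?]] //= _; rewrite ?mxE /=).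
  by rewrite expr0 expr1; ring.
(* Coordinates in the basis vec(i+1,j), vec(i+1,j+1): [p2] is read off [lift_pos], and [p4] is the
   face equation at (i,j) solved for ca vec(i,j) + cc vec(i,j+1). *)
rewrite (cross_ratioE ind (p1 := v 1 0) (p2 := v (ca X (i + 1) j) (cc X (i + 1) j))
  (p3 := v 0 1) (p4 := v (- cb X i j) 1)).
- rewrite /cr2 !dv /hinv; field.
  exact: a1.
- by rewrite v0 ?oner_eq0.
- by rewrite v0 ?a1.
- by rewrite v0 ?oner_eq0 ?orbT.
- by rewrite v0 ?oner_eq0 ?orbT.
- by rewrite lv scale1r scale0r addr0.
- by rewrite lv.
- by rewrite lv scale1r scale0r add0r.
- by rewrite lv Y0 e /=; congr <[_]>%VS; apply/rowP => k; rewrite !mxE; ring.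

rewrite Y0 Y1 E1 E12.
set L := (X in \dim X); have -> : L = <<[:: vec X (i + 1) j; vec X (i + 1) (j + 1)]>>%VS.
  have ey : vec (lift_pos X) i j =
      - cb X i j *: vec X (i + 1) j + 1 *: vec X (i + 1) (j + 1).
    by rewrite e /=; apply/rowP => k; rewrite !mxE; ring.
  rewrite span_cons span_seq1 /L; apply/eqP; rewrite eqEsubv !subv_add addvSl addvSr.
  rewrite -!memvE ey !memv_add ?memvZ ?memv_line //= !memvE.
  rewrite -!addvA addvSl /=.
  exact: subv_trans (addvSl _ _) (subv_trans (addvSr _ _) (addvSr _ _)).
by rewrite (eqP ind).
Qed.

(** * Mirror statements for K and the negative transform *)

Lemma invKE N X i j : lifts N X -> nondegenerate N ->
  face N i j -> face N i (j + 1) -> invK N i (j + 1) = kinv X i j.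
Proof.
move=> lX nd f g; exact: (invHE (lifts_tr lX) (nondegenerate_tr nd)
  (etrans (face_tr _ _ _) f) (etrans (face_tr _ _ _) g)).
Qed.

Lemma laplace_neg_eq N X i j : lifts N X -> nondegenerate N ->
  face N i j -> face N i (j + 1) ->
  laplace_neg N i j = laplace_neg N i (j + 1) <-> kinv X i j = 1.
Proof.
move=> lX nd f g.
exact: (laplace_pos_eq (lifts_tr lX) (nondegenerate_tr nd)
  (etrans (face_tr _ _ _) f) (etrans (face_tr _ _ _) g)).
Qed.

Lemma lifts_neg N X : lifts N X -> nondegenerate N ->
  (forall i j, face N i j -> face N i (j + 1) ->
     laplace_neg N i j <> laplace_neg N i (j + 1)) ->
  lifts (laplace_neg N) (lift_neg X).
Proof.
move=> lX nd ne; rewrite laplace_neg_tr; apply/lifts_tr/lifts_pos.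
- exact: lifts_tr.
- exact: nondegenerate_tr.
- by move=> i j; rewrite !face_tr; apply: ne.
Qed.

Lemma hinv_lift_neg N X i j : lifts N X -> lifts (laplace_neg N) (lift_neg X) ->
  face (laplace_neg N) i j -> face (laplace_neg N) (i + 1) j ->
  hinv (lift_neg X) i j = kinv X (i + 1) j.
Proof.
rewrite laplace_neg_tr => lX lY f g; rewrite !face_tr in f g.
exact: (kinv_lift_pos (lifts_tr lX) (lifts_tr lY)).
Qed.

Lemma kinv_lift_neg N X i j : lifts N X -> lifts (laplace_neg N) (lift_neg X) ->
  face (laplace_neg N) i j -> face (laplace_neg N) i (j + 1) ->
  kinv (lift_neg X) i j = kinv X i j * kinv X (i + 1) (j + 1) / hinv X i (j + 1)
    * ((1 - kinv X (i + 1) j) * (1 - kinv X i (j + 1)))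
    / ((1 - kinv X i j) * (1 - kinv X (i + 1) (j + 1))).
Proof.
rewrite laplace_neg_tr => lX lY f g; rewrite !face_tr in f g.
exact: (hinv_lift_pos (lifts_tr lX) (lifts_tr lY)).
Qed.

(** * The diagonal net and the swap of invariants *)

Definition lift_diag X : lift :=
  Lift (fun i j => cb X i j *: vec X (i + 1) j + cc X i j *: vec X i (j + 1))
    (fun i j => cb X (i + 1) (j + 1) * ca X (i + 1) j / cb X i j)
    (fun i j => cb X (i + 1) (j + 1)) (fun i j => cc X (i + 1) (j + 1)).

(* Expanding d(i+1,j+1) = cb(i+1,j+1) vec(i+2,j+1) + cc(i+1,j+1) vec(i+1,j+2)
   leaves combinations of d(i+1,j), d(i,j+1), vec(i+1,j) and vec(i,j+1); this
   identity says that the last two combine to a multiple of d(i,j). *)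
Lemma BSKoenigs_lift N X i j : lifts N X -> is_BSKoenigs N ->
  face (diagonal_net N) i j ->
  cb X (i + 1) (j + 1) * ca X (i + 1) j / cb X i j =
  cc X (i + 1) (j + 1) * ca X i (j + 1) / cc X i j.
Proof.
move=> lX [_ nd hk] f; have [f1 f2 f3 f4] := face_corners f.
have [_ a1 b1 c1] := lX.2 _ _ f1; have [_ a2 b2 c2] := lX.2 _ _ f2.
have [_ a3 b3 c3] := lX.2 _ _ f3; have [_ a4 b4 c4] := lX.2 _ _ f4.
have [d1 d2 d3 d4] := face_corners f1; have [_ d5 _ d6] := face_corners f2.
have [_ _ d7 d8] := face_corners f3.
have := hk (i + 1) j d2; rewrite /domH /domK !addrK /= d2 d3 d4 d6 d8.
rewrite !(invHE lX, invKE lX) //.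
move: f1 f2 f3 f4 => /= -> -> -> -> /(_ isT isT isT isT).
rewrite /kinv /hinv /= => e.
(* The factor that turns the K side of the Koenigs equation into the left side of the goal, and the
   H side into the right side. *)
pose k := ca X (i + 1) j * ca X i (j + 1) * ca X (i + 1) (j + 1)
  / (cc X (i + 1) j * cb X i (j + 1) * cb X i j * cc X i j).
transitivity (- (cb X (i + 1) (j + 1) * cc X (i + 1) j) / ca X (i + 1) (j + 1) *
    (- (cb X i (j + 1) * cc X i j) / ca X i (j + 1)) * k).
  by rewrite /k; field; rewrite a3 a4 b1 b3 c1 c2.
by rewrite -e /k; field; rewrite a2 a4 b1 b3 c1 c2.
Qed.

Lemma lifts_diag N X : lifts N X -> is_BSKoenigs N ->
  lifts (diagonal_net N) (lift_diag X).
Proof.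
move=> lX kN; have [_ nd _] := kN; split=> i j.
  move=> /= f; have [d1 d2 d3 d4] := face_corners f; case: (lX) => h1 h2.
  have [e _ b0 c0] := h2 _ _ f; split.
    apply/eqP => /= y0.
    case: (lifts_face lX nd f (a := 0) (b := cb X i j) (c := cc X i j)).
      by rewrite scale0r add0r.
    by move=> _ /eqP; rewrite (negPf b0).
  rewrite (h1 _ _ d1).2 (h1 _ _ d2).2 (h1 _ _ d3).2 (h1 _ _ d4).2 capvC.
  have -> : vec X (i + 1) (j + 1) = cb X i j *: vec X (i + 1) j
      + ca X i j *: vec X i j + cc X i j *: vec X i (j + 1).
    by rewrite e [_ *: _ + _ *: vec X (i + 1) j]addrC.
  rewrite line_meet // (addvC <[_]>%VS <[vec X i j]>%VS).
  case: nd => _ _ /(_ _ _ f)[+ _ _ _].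
  by rewrite (h1 _ _ d1).2 (h1 _ _ d2).2 (h1 _ _ d3).2.
move=> f; have bk := BSKoenigs_lift lX kN f; have [f1 f2 f3 f4] := face_corners f.
have [e1 a1 b1 c1] := lX.2 _ _ f1; have [e2 a2 b2 c2] := lX.2 _ _ f2.
have [e3 a3 b3 c3] := lX.2 _ _ f3; have [_ a4 b4 c4] := lX.2 _ _ f4.
split; rewrite /= ?mulf_neq0 ?invr_neq0 //.
(* In the vec(i,j+1) term, [bk] replaces the quotient over cb(i,j) by one over cc(i,j), so that both
   denominators cancel. *)
rewrite scalerDr !scalerA {2}bk !divfK // e2 e3 e1.
by apply/rowP => k; rewrite !mxE; ring.
Qed.

(** K_M(i,j) = H_N(i+1,j) and H_M(i,j) = K_N(i,j+1); the indices differ because [hinv] and [kinv]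
    carry shifts of their own. *)
Definition swapped N X Y M : Prop := forall i j,
  (face M i j -> face M i (j + 1) -> kinv Y i j = hinv X i (j + 1)) /\
  (face M i j -> face M (i + 1) j -> hinv Y i j = kinv X (i + 1) j).

Lemma swapped_diag N X : lifts N X -> is_BSKoenigs N ->
  swapped N X (lift_diag X) (diagonal_net N).
Proof.
move=> lX kN i j; split=> f g.
  have [f1 f2 f3 f4] := face_corners f; have [_ _ g3 g4] := face_corners g.
  have [_ _ b3 _] := lX.2 _ _ f3; have [_ a4 _ _] := lX.2 _ _ f4.
  have [_ _ b6 _] := lX.2 _ _ g4.
  by rewrite /kinv /hinv /=; field; rewrite a4 b3 b6. 
have [f1 f2 f3 f4] := face_corners f; have [_ g2 _ g4] := face_corners g.
have [_ _ _ c2] := lX.2 _ _ f2; have [_ a4 _ _] := lX.2 _ _ f4.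
have [_ _ _ c6] := lX.2 _ _ g4.
rewrite /kinv /hinv [ca (lift_diag X) _ _](BSKoenigs_lift lX kN g) /=.
by field; rewrite a4 c2 c6.
Qed.

(** Substituting the swap into the recursion of [M] under [laplace_neg] gives the recursion of [N]
    under [laplace_pos], up to the order of two factors. *)
Lemma swapped_laplace N X M Y : dom M =2 face N ->
  lifts N X -> lifts (laplace_pos N) (lift_pos X) ->
  lifts M Y -> lifts (laplace_neg M) (lift_neg Y) ->
  swapped N X Y M ->
  swapped N (lift_pos X) (lift_neg Y) (laplace_neg M).
Proof.
move=> dM lX lX' lY lY' sw i j.
have fN k l : face M k l -> face (laplace_pos N) k l.
  by rewrite /face /= -!dM.
split=> f g; have [/fN f1 /fN f2 /fN f3 /fN f4] := face_corners f.
  have [m1 m2 m3 m4] := face_corners f; have [_ _ m5 m6] := face_corners g.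
  rewrite (kinv_lift_neg lY lY' f g) (hinv_lift_pos lX lX' f3 f4).
  rewrite (sw i j).1 // (sw (i + 1) j).1 // (sw i (j + 1)).1 //.
  rewrite (sw (i + 1) (j + 1)).1 // (sw i (j + 1)).2 //.
  by rewrite [X in _ * X / _]mulrC.
have [m1 m2 m3 m4] := face_corners f; have [_ m5 _ m6] := face_corners g.
rewrite (hinv_lift_neg lY lY' f g) (kinv_lift_pos lX lX' f2 f4).
by rewrite (sw (i + 1) j).1.
Qed.

Lemma dom_iter_diagonal k N :
  dom (iter_neg k (diagonal_net N)) =2 face (iter_pos k N).
Proof.
elim: k => [|k IH] i j //=.
by rewrite {1}/face !IH.
Qed.

(** A lift passes to a transform whose adjacent points differ in the relevant direction. Below level
    k this is part of non-degeneracy; at level k it is a hypothesis that a Goursat degenerate net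
    also meets. *)
Lemma swapped_iter k P : is_BSKoenigs P ->
  (forall l, (l < k)%N -> nondegenerate (iter_pos l P)) ->
  (forall l, (l < k)%N -> nondegenerate (iter_neg l (diagonal_net P))) ->
  (forall i j, dom (iter_pos k P) i j -> dom (iter_pos k P) (i + 1) j ->
     iter_pos k P i j <> iter_pos k P (i + 1) j) ->
  (forall i j, dom (iter_neg k (diagonal_net P)) i j ->
     dom (iter_neg k (diagonal_net P)) i (j + 1) ->
     iter_neg k (diagonal_net P) i j <> iter_neg k (diagonal_net P) i (j + 1)) ->
  exists X Y, [/\ lifts (iter_pos k P) X, lifts (iter_neg k (diagonal_net P)) Y
    & swapped (iter_pos k P) X Y (iter_neg k (diagonal_net P))].
Proof.
move=> kP; elim: k => [|k IH] hp hn ep en.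
  have [qP ndP _] := kP; have [X lX] := exists_lift qP ndP.
  by exists X, (lift_diag X); split; [|exact: lifts_diag|exact: swapped_diag].
have [ndp ndn] := (hp _ (leqnn _), hn _ (leqnn _)).
have [|||| X [Y [lX lY sw]]] := IH.
- by move=> l /ltnW; apply: hp.
- by move=> l /ltnW; apply: hn.
- by case: ndp.
- by case: ndn.
have lX' := lifts_pos lX ndp ep; have lY' := lifts_neg lY ndn en.
exists (lift_pos X), (lift_neg Y); split=> //.
exact: swapped_laplace (dom_iter_diagonal k P) lX lX' lY lY' sw.
Qed.

(** * Shape of the domains, and constancy along rows and columns *)

Lemma convex_const (T : Type) (I : int -> bool) (f : int -> T) :
  (forall a b c, a <= b <= c -> I a -> I c -> I b) ->
  (forall a, I a -> I (a + 1) -> f a = f (a + 1)) ->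
  forall a b, I a -> I b -> f a = f b.
Proof.
move=> cv st; suff h k a : I a -> I (a + k%:Z) -> f a = f (a + k%:Z).
  move=> a b Ia Ib; case/orP: (le_total a b) => ab.
    have e : a + `|b - a|%N = b by lia.
    by rewrite -e; apply: h; rewrite ?e.
  have e : b + `|a - b|%N = a by lia.
  by rewrite -e; apply/esym/h; rewrite ?e.
elim: k => [|k IH] Ia Ik; first by rewrite addr0.
have Ik' : I (a + k%:Z) by apply: cv Ia Ik; lia.
have e : a + k.+1%:Z = a + k%:Z + 1 by lia.
by rewrite IH // e st // -e.
Qed.

(** A property stable under passing to faces, so that one induction covers all iterated domains of
    the lattice and of grids. *)
Definition rectangular N : Prop :=
  [/\ forall i j i' j', dom N i j -> dom N i' j' -> dom N i j',
      forall j a b c, a <= b <= c -> dom N a j -> dom N c j -> dom N b j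
    & forall i a b c, a <= b <= c -> dom N i a -> dom N i c -> dom N i b].

Lemma rectangular_face N M : dom M =2 face N -> rectangular N -> rectangular M.
Proof.
move=> dM [h1 h2 h3]; split.
- move=> i j i' j'; rewrite !dM => /and4P[a1 a2 a3 a4] /and4P[b1 b2 b3 b4].
  by apply/and4P; split; [apply: h1 a1 b1|apply: h1 a2 b1|apply: h1 a1 b3|
    apply: h1 a2 b3].
- move=> j a b c abc; have abc' : a + 1 <= b + 1 <= c + 1 by lia.
  rewrite !dM => /and4P[a1 a2 a3 a4] /and4P[b1 b2 b3 b4].
  by apply/and4P; split; [apply: h2 abc a1 b1|apply: h2 abc' a2 b2|
    apply: h2 abc a3 b3|apply: h2 abc' a4 b4].
- move=> i a b c abc; have abc' : a + 1 <= b + 1 <= c + 1 by lia.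
  rewrite !dM => /and4P[a1 a2 a3 a4] /and4P[b1 b2 b3 b4].
  by apply/and4P; split; [apply: h3 abc a1 b1|apply: h3 abc a2 b2|
    apply: h3 abc' a3 b3|apply: h3 abc' a4 b4].
Qed.

Lemma rectangular_iter_pos k S p :
  rectangular (iter_pos k (Net (mem_index S) p) : net R n).
Proof.
elim: k => [|k]; last exact: rectangular_face.
by case: S => [|a b]; split=> //= *; lia.
Qed.

Lemma rectangular_iter_neg k S p :
  rectangular (iter_neg k (diagonal_net (Net (mem_index S) p)) : net R n).
Proof.
exact: rectangular_face (dom_iter_diagonal k _) (rectangular_iter_pos k S p).
Qed.

(** The invariants compare neighbours only; convexity of the columns of the domain bridges to
    arbitrary pairs. *)
Lemma laplace_degenerate_negP k N : rectangular (iter_neg k N) -> exists_neg k N ->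
  laplace_degenerate_neg k N <->
  (forall i j, dom (iter_neg k N) i j -> dom (iter_neg k N) i (j + 1) ->
     iter_neg k N i j = iter_neg k N i (j + 1)).
Proof.
move=> [_ _ cv] ex; split=> [[_ h] i j|h]; first exact: h.
split=> // i j j'.
apply: (@convex_const _ _ (fun j => iter_neg k N i j)) => [a b c|a].
  exact: cv.
exact: h.
Qed.

Lemma inner_laplace_degenerate_posP k N :
  rectangular (iter_pos k N) -> exists_pos k N ->
  inner_laplace_degenerate_pos k N <->
  (forall i j, face (iter_pos k N) i j -> face (iter_pos k N) i (j + 1) ->
     iter_pos k N i (j + 1) = iter_pos k N (i + 1) (j + 1)).
Proof.
move=> [rc cv _] ex; split=> [[_ h] i j f g|h].
  have [f1 f2 f3 f4] := face_corners f; have [_ _ g3 _] := face_corners g.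
  by apply: h => //; rewrite addrK.
split=> // i i' j d d' dm dp.
apply: (@convex_const _ (fun i => dom (iter_pos k N) i j)
  (fun i => iter_pos k N i j)) d d' => [a b c|a d1 d2].
  exact: cv.
(* Row j becomes [l + 1], shared by two stacked faces. Rows l and l+2 are known at column i;
   rectangularity extends them to the other columns. *)
rewrite -(subrK 1 j) in dm dp d1 d2 *; move: (j - 1) => l in dm dp d1 d2 *.
have nb a' : dom (iter_pos k N) a' (l + 1) ->
    dom (iter_pos k N) a' l /\ dom (iter_pos k N) a' (l + 1 + 1).
  by move=> da; split; [rewrite addrK in dm; exact: rc da dm|exact: rc da dp].
have [[? ?] [? ?]] := (nb _ d1, nb _ d2).
by apply: h; apply/and4P; split.
Qed.

End Nets.

(** D_{-m} lives on the faces of P_m, and its equality at (i,j), (i,j+1) matches that of P_m at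
    (i,j+1), (i+1,j+1). On a grid this never reaches the bottom and top rows of P_m, hence the inner
    form of the equivalence. *)
Theorem theorem3p18 (R : realType) (n m : nat) (S : index_set)
    (p : int -> int -> psubspace R n) :
  (0 < m)%N ->
  let P := Net (mem_index S) p in
  let D := diagonal_net P in
  is_BSKoenigs P ->
  (exists_pos m P -> exists_neg m D ->
     [/\ S = Lattice ->
           (laplace_degenerate_pos m P <-> laplace_degenerate_neg m D),
         laplace_degenerate_pos m P -> laplace_degenerate_neg m D
       & laplace_degenerate_neg m D <-> inner_laplace_degenerate_pos m P]) /\
  (exists_neg m.+1 D ->
     goursat_degenerate_pos m P -> laplace_degenerate_neg m.+1 D).
Proof.
move=> m0 P D kP; split=> [exP exD|exD [exP hj hn]].
  have key : laplace_degenerate_neg m D <-> inner_laplace_degenerate_pos m P.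
    rewrite laplace_degenerate_negP //; last exact: rectangular_iter_neg.
    rewrite inner_laplace_degenerate_posP //; last exact: rectangular_iter_pos.
    (* With m = k + 1, P_k and D_{-k} are non-degenerate, so their invariants decide equality of
       neighbours in P_m and D_{-m}. *)
    case: m m0 exP exD => // k _ [ndP _] [ndD _].
    have [||||X [Y [lX lY sw]]] := swapped_iter (k := k) kP.
    - by move=> l /ltnW; apply: ndP.
    - by move=> l /ltnW; apply: ndD.
    - by case: (ndP _ (leqnn _)).
    - by case: (ndD _ (leqnn _)).
    have eqv i j : face (iter_neg k D) i j -> face (iter_neg k D) i (j + 1) ->
        (iter_neg k.+1 D i j = iter_neg k.+1 D i (j + 1) <->
         iter_pos k.+1 P i (j + 1) = iter_pos k.+1 P (i + 1) (j + 1)).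
      move=> f g; have := face_corners f; rewrite !dom_iter_diagonal => -[_ _ f3 f4].
      rewrite (laplace_neg_eq lY (ndD _ (leqnn _)) f g) (sw i j).1 //.
      by rewrite (laplace_pos_eq lX (ndP _ (leqnn _)) f3 f4).
    have fE i j : face (iter_neg k D) i j = face (iter_pos k.+1 P) i j.
      by rewrite {1}/face !dom_iter_diagonal.
    split=> h i j f g.
      have f' : face (iter_neg k D) i j by rewrite fE.
      have g' : face (iter_neg k D) i (j + 1) by rewrite fE.
      exact: (eqv i j f' g').1 (h i j f' g').
    by apply: (eqv i j f g).2; apply: h; rewrite -fE.
  have posinner : laplace_degenerate_pos m P -> inner_laplace_degenerate_pos m P.
    by case=> ex h; split=> // i i' j d d' _ _; apply: h.
  split=> // [SL|/posinner/key //].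
  split=> [/posinner/key //|/key[_ h]].
  (* On the lattice every iterated domain is everything, so every row is an inner one. *)
  have allD k i j : dom (iter_pos k P) i j.
    by elim: k i j => [|k IH] i j; [rewrite /= SL|rewrite /= /face !IH].
  by split=> // i i' j _ _; apply: h.
apply/laplace_degenerate_negP => //; first exact: rectangular_iter_neg.
have [ndD _] := exD.
(* Applied at level m itself: P_m has distinct horizontal neighbours because it is nowhere Laplace
   degenerate, and D_{-m} is non-degenerate because D_{-m-1} exists. *)
have [||||X [Y [lX lY sw]]] := swapped_iter (k := m) kP.
- exact: exP.1.
- by move=> l /ltnW; apply: ndD.
- exact: hn.2.
- by case: (ndD _ (leqnn _)).
move=> i j f g; apply/(laplace_neg_eq lY (ndD _ (leqnn _)) f g).
rewrite (sw i j).1 //.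
have := face_corners f; rewrite !dom_iter_diagonal => -[_ _ f3 f4].
by apply: goursat_hinv lX _ _ f3 f4 => k; [exact: hj|exact: hn.2].
Qed.
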